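(* Let $G=(X,Y)$ be a bipartite graph with $|X|\ge 2$ satisfying the double Hall property. If $\deg(y)\in\{2,\,|X|-2,\,|X|-1,\,|X|\}$ for every $y\in Y$, then $G$ contains a cycle $C$ with $X\subseteq V(C)$.
   Context: All graphs are finite and simple. For a vertex set $S$, $\Lambda^2(S)$ denotes the set of vertices adjacent to at least two vertices of $S$. A bipartite graph $G=(X,Y)$ with $|X|\ge 2$ satisfies the double Hall property if $|\Lambda^2(S)|\ge |S|$ for every $S\subseteq X$ with $|S|\ge 2$. *)

(* Defs.v *)
From mathcomp Require Import all_boot.
Set Implicit Arguments.
Unset Strict Implicit.
Unset Printing Implicit Defensive.

Section Graph.
Variables (V : finType) (e : rel V).

Definition simple_graph : Prop := symmetric e /\ irreflexive e.

Definition bipartite_graph (X Y : {set V}) : Prop :=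
  [/\ simple_graph,
      X :|: Y = [set: V],
      [disjoint X & Y]
    & forall u v, e u v -> (u \in X) && (v \in Y) || (u \in Y) && (v \in X)].

Definition neighbors (v : V) : {set V} := [set u | e v u].

Definition degree (v : V) : nat := #|neighbors v|.

Definition Lambda2 (S : {set V}) : {set V} :=
  [set v | 2 <= #|neighbors v :&: S|].

Definition double_hall (X : {set V}) : Prop :=
  forall S : {set V}, S \subset X -> 2 <= #|S| -> #|S| <= #|Lambda2 S|.

(* ucycle alone also accepts the empty sequence and, for a symmetric e,
   a single edge traversed back and forth; the size bound excludes these. *)
Definition graph_cycle (c : seq V) : Prop := 3 <= size c /\ ucycle e c.

End Graph.

(* Main.v *)
Require Import Defs.
From mathcomp Require Import all_boot zify.

Set Implicit Arguments.
Unset Strict Implicit.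
Unset Printing Implicit Defensive.

(* View each y as a hyperedge on X.  A hyperedge of degree at least 3 ("large")
   misses at most two vertices of X.  Order X cyclically so that the number of
   consecutive pairs joined by a hyperedge of degree 2 is maximal and, subject
   to that, so that the number of incidences between a consecutive pair and a
   large hyperedge missing both its vertices is maximal.  The remaining
   consecutive pairs ("weak links") must be given distinct large hyperedges.
   Every exchange of two links by reversing a segment is unprofitable, so first
   (or second) ends of weak links are pairwise not joined by a hyperedge of
   degree 2, and the double Hall property on sets of such ends only counts
   large hyperedges.  If Hall's condition failed for a set L of weak links, a
   large hyperedge containing no link of L would force |L| <= 4, since the two
   vertices it misses lie on at most four links; the cases |L| = 3 and |L| = 4
   contradict the unprofitability of an exchange. *)

(** * Hall's marriage theorem for finite families of sets *)

(** Induction on [#|D|]. If a nonempty proper subset [S] is tight, match [S] first and then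
    [D :\: S] away from the neighbours of [S]. Otherwise every such subset has a surplus, so any [a]
    may take any [b] in [N a]. The point [b0] gives a total function when [D] is empty. *)
Lemma hall_marriage (A B : finType) (b0 : B) (N : A -> {set B}) (D : {set A}) :
    (forall S : {set A}, S \subset D -> #|S| <= #|\bigcup_(a in S) N a|) ->
  exists f : A -> B, {in D &, injective f} /\ {in D, forall a, f a \in N a}.
Proof.
have [n] := ubnP #|D|; elim: n => // n IHn in N D *; rewrite ltnS => leDn hallD.
have [D0|[a aD]] := set_0Vmem D.
  by exists (fun=> b0); split=> [x y|x]; rewrite D0 inE.
case: (boolP [exists S : {set A}, [&& S \proper D, S != set0 &
               #|\bigcup_(x in S) N x| <= #|S|]])
  => [/existsP[S /and3P[prS S0 tight]]|].
  have sSD := proper_sub prS.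
  have [||f1 [inj1 N1]] := IHn N S.
  - by have := proper_card prS; lia.
  - by move=> T sTS; apply: hallD; apply: subset_trans sSD.
  have cardD : #|D :\: S| + #|S| = #|D|.
    by rewrite -(cardsID S D) (setIidPr sSD) addnC.
  have S_gt0 : 0 < #|S| by rewrite card_gt0.
  have [||f2 [inj2 N2]] := IHn (fun x => N x :\: \bigcup_(y in S) N y) (D :\: S).
  - by lia.
  - move=> T sT; have dTS : [disjoint T & S].
      by rewrite disjoint_sym disjoints_subset; apply/subsetP=> x xS; rewrite inE;
         apply/negP=> /(subsetP sT); rewrite inE xS.
    have sTSD : T :|: S \subset D.
      by rewrite subUset sSD andbT (subset_trans sT) ?subsetDl.
    (* Hall's condition for [T :|: S], minus the at most [#|S|] neighbours of the tight set [S],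
       leaves at least [#|T|] elements in the reduced sets. *)
    have := hallD _ sTSD; rewrite cardsU (disjoint_setI0 dTS) cards0 subn0 => le1.
    have : #|\bigcup_(x in T :|: S) N x| <=
       #|\bigcup_(x in T) (N x :\: \bigcup_(y in S) N y)| + #|\bigcup_(x in S) N x|.
      apply: leq_trans (leq_card_setU _ _); apply: subset_leq_card.
      apply/subsetP=> b /bigcupP[x xTS bx]; rewrite inE orbC.
      have [//|bS] := boolP (b \in \bigcup_(y in S) N y); apply/bigcupP.
      exists x; last by rewrite inE bS.
      by case/setUP: xTS => // xS; case/negP: bS; apply/bigcupP; exists x.
    by lia.
  have sep x y : x \in S -> y \in D -> y \notin S -> f1 x <> f2 y.
    move=> xS yD yS eqf; have := N2 y; rewrite !inE yS yD => /(_ isT)/andP[/negP[]].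
    by apply/bigcupP; exists x => //; rewrite -eqf N1.
  exists (fun x => if x \in S then f1 x else f2 x); split=> [x y xD yD|x xD].
    have [xS|xS] := boolP (x \in S); have [yS|yS] := boolP (y \in S).
    - exact: inj1.
    - by move/sep=> [].
    - by move/esym/sep=> [].
    - by apply: inj2; rewrite inE ?xS ?yS.
  have [xS|xS] := boolP (x \in S); first exact: N1.
  by have := N2 x; rewrite !inE xS xD => /(_ isT)/andP[].
rewrite negb_exists => /forallP noTight.
have [b bNa] : exists b, b \in N a.
  have /hallD : [set a] \subset D by rewrite sub1set.
  by rewrite cards1 big_set1 card_gt0 => /set0Pn.
have [||f [injf Nf]] := IHn (fun x => N x :\ b) (D :\ a).
- by have := cardsD1 a D; rewrite aD; lia.
- move=> T sT; have [->|T0] := eqVneq T set0; first by rewrite cards0.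
  have prT : T \proper D.
    apply: sub_proper_trans sT _; apply/properP; split; first exact: subsetDl.
    by exists a => //; rewrite !inE eqxx.
  have := noTight T; rewrite prT T0 /= -ltnNge.
  suff : #|\bigcup_(x in T) N x| <= #|\bigcup_(x in T) (N x :\ b)| + #|[set b]|.
    by rewrite cards1; lia.
  apply: leq_trans (leq_card_setU _ _); apply: subset_leq_card.
  apply/subsetP=> c /bigcupP[x xT cx]; rewrite !inE orbC.
  by have [//|cb] := eqVneq c b; apply/bigcupP; exists x; rewrite ?inE ?cb.
have fNb x : x \in D -> x != a -> f x != b.
  by move=> xD xa; have := Nf x; rewrite !inE xa xD => /(_ isT)/andP[].
exists (fun x => if x == a then b else f x); split=> [x y xD yD|x xD].
  have [->|xa] := eqVneq x a; have [->|ya] := eqVneq y a => //.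
  - by move/esym/eqP; rewrite (negPf (fNb _ _ _)).
  - by move/eqP; rewrite (negPf (fNb _ _ _)).
  - by apply: injf; rewrite !inE ?xa ?ya.
have [->//|xa] := eqVneq x a.
by have := Nf x; rewrite !inE xa xD => /(_ isT)/andP[].
Qed.

(** * Weights of cyclic orders and reversal of segments *)

Section CyclicWeight.
Variables (V : finType) (w : V -> V -> nat).
Hypothesis wC : forall u v, w u v = w v u.

Definition path_weight (x : V) (s : seq V) := sumn (pairmap w x s).
Arguments path_weight : simpl never.

Definition cycle_weight (s : seq V) :=
  if s is x :: s' then path_weight x (rcons s' x) else 0.

Lemma path_weight_cat x s1 s2 :
  path_weight x (s1 ++ s2) = path_weight x s1 + path_weight (last x s1) s2.
Proof. by rewrite /path_weight pairmap_cat sumn_cat. Qed.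

Lemma path_weight_nil x : path_weight x [::] = 0.
Proof. by []. Qed.

Lemma path_weight_cons x y s :
  path_weight x (y :: s) = w x y + path_weight y s.
Proof. by []. Qed.

Lemma path_weight_rcons x s y :
  path_weight x (rcons s y) = path_weight x s + w (last x s) y.
Proof. by rewrite -cats1 path_weight_cat path_weight_cons addn0. Qed.

(** [rev (belast x s)] is [x :: s] read backwards without its new starting point [last x s];
    symmetry of [w] preserves each term. *)
Lemma path_weight_rev x s :
  path_weight (last x s) (rev (belast x s)) = path_weight x s.
Proof.
elim: s x => [|y s IHs] x //=; rewrite rev_cons path_weight_rcons IHs.
rewrite path_weight_cons addnC -(last_cons x) -rev_rcons -lastI rev_cons.
by rewrite last_rcons wC.
Qed.

Lemma cycle_weight_catC s1 s2 : cycle_weight (s1 ++ s2) = cycle_weight (s2 ++ s1).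
Proof.
case: s1 s2 => [|x p] [|y q]; rewrite ?cats0 //=.
rewrite !path_weight_rcons !path_weight_cat !path_weight_cons !last_cat /=.
by lia.
Qed.

Lemma cycle_weight_rot i s : cycle_weight (rot i s) = cycle_weight s.
Proof. by rewrite /rot cycle_weight_catC cat_take_drop. Qed.

(* Reversing a segment exchanges two links and keeps all others, so an order
   of maximal weight cannot be improved by such an exchange. *)
Lemma max_cyclic_order (X : {set V}) :
  exists s : seq V, [/\ uniq s, s =i X &
    {in X &, forall u v, u != v ->
      w u v + w (next s u) (next s v) <= w u (next s u) + w v (next s v)}].
Proof.
pose P (t : #|X|.-tuple V) := perm_eq t (enum X).
have sz : size (enum X) == #|X| by rewrite -cardE.
have Pt0 : P (Tuple sz) by rewrite /P.
case: (arg_maxnP (fun t : #|X|.-tuple V => cycle_weight t) Pt0) => t Pt maxt.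
have ut : uniq t by rewrite (perm_uniq Pt) enum_uniq.
have tX : t =i X by move=> x; rewrite (perm_mem Pt) mem_enum.
exists t; split=> // u v uX vX uv.
have [i s' def_t] : rot_to_spec t u by apply: rot_to; rewrite tX.
have vs' : v \in s'.
  by have := tX v; rewrite -(mem_rot i) def_t vX inE eq_sym (negPf uv).
case/path.splitP: vs' def_t => A B def_t.
have ns : fcycle (next t) (u :: rcons A v ++ B).
  by rewrite -def_t rot_cycle; apply: cycle_next.
have Pc c : perm_eq c (rot i t) -> cycle_weight c <= cycle_weight t.
  move=> pc; have pc' : perm_eq c (enum X) by rewrite (permPl pc) perm_rot.
  have szc : size c == #|X| by rewrite (perm_size pc').
  by apply: (maxt (Tuple szc)).
(* Reversing the segment from the successor of [u] up to [v] trades the links leaving [u] and [v]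
   for the pair [u], [v] and the pair of their successors. *)
have := Pc (u :: rev (rcons A v) ++ B).
rewrite def_t perm_cons perm_cat2r perm_rev => /(_ (perm_refl _)).
rewrite -(cycle_weight_rot i t) {}def_t {Pc}.
move: ns; rewrite /= !rcons_cat !cat_path !last_rcons !path_weight_cat.
rewrite last_rcons rev_rcons /= => /andP[nu nv].
have {}nv : next t v = head u B by case: B nv => [|b B] /= /andP[/eqP].
case: A nu => [|a A] /= /andP[/eqP nu _].
  by rewrite nu nv; case: B nv => [|b B] _ /=; rewrite ?path_weight_cons; lia.
rewrite nu nv !path_weight_cons !path_weight_rcons rev_cons last_rcons.
rewrite path_weight_rcons.
have := path_weight_rev a (rcons A v).
rewrite belast_rcons rev_cons last_rcons path_weight_rcons path_weight_rcons.
by case: B {nv} => [|b B] /=; rewrite ?path_weight_cons ?path_weight_nil; lia.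
Qed.
End CyclicWeight.

(** * Counting with inclusions of finite sets *)

Lemma card_ltn_setD (T : finType) (A B : {set T}) :
  #|A| < #|B| -> exists x, x \in B :\: A.
Proof.
rewrite ltnNge => ltAB; apply/set0Pn; rewrite setD_eq0.
by apply: contra ltAB; apply: subset_leq_card.
Qed.

Lemma ltn_cardsU1 (T : finType) (x : T) (A N : {set T}) n :
  x \in N -> x \notin A -> A \subset N -> n <= #|A| -> n < #|N|.
Proof.
move=> xN xA sAN leA; have : x |: A \subset N by rewrite subUset sub1set xN.
by move/subset_leq_card; rewrite cardsU1 xA; apply: leq_trans.
Qed.

(** * Hall's condition for the weak links *)

Section HallCondition.
Variables (V : finType) (e adj : rel V) (X K : {set V}) (s p : V -> V).

(** In this section [s] and [p] stand for successor and predecessor in the cyclic order, [K] for the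
    large hyperedges, and [adj] for being joined by a hyperedge of degree 2. This count is the
    secondary weight of a pair. *)
Definition common_misses (u v : V) := #|[set h in K | ~~ e h u && ~~ e h v]|.

(** A link is recorded by its first end [u]; its second end is [s u]. *)
Definition weak_links := [set u in X | ~~ adj u (s u)].

Hypothesis sX : {in X, forall u, s u \in X}.
Hypothesis s_inj : injective s.
Hypothesis psK : cancel p s.
Hypothesis s_neq : {in X, forall u, s u != u}.
Hypothesis ss_neq : {in X, forall u, s (s u) != u}.
Hypothesis missK : {in K, forall h, #|[set u in X | ~~ e h u]| <= 2}.
Hypothesis pairK : forall u v, u \in X -> v \in X -> u != v -> ~~ adj u v ->
  2 <= #|[set h in K | e h u && e h v]|.
Hypothesis tripleK : forall u v x, u \in X -> v \in X -> x \in X ->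
  u != v -> u != x -> v != x -> ~~ adj u v -> ~~ adj u x -> ~~ adj v x ->
  3 <= #|[set h in K | [|| e h u && e h v, e h u && e h x | e h v && e h x]]|.
Hypothesis weak_nadj : {in weak_links &, forall u v, u != v -> ~~ adj u v}.
Hypothesis weak_nadjS : {in weak_links &, forall u v, u != v -> ~~ adj (s u) (s v)}.
Hypothesis swap_links : {in weak_links &, forall u v, u != v ->
  common_misses u v + common_misses (s u) (s v)
    <= common_misses u (s u) + common_misses v (s v)}.
Hypothesis leWK : #|weak_links| <= #|K|.

Lemma hits_third h u v x : h \in K -> u \in X -> v \in X -> x \in X ->
  u != v -> u != x -> v != x -> ~~ e h u -> ~~ e h v -> e h x.
Proof.
move=> hK uX vX xX uv ux vx eu ev; apply/negPn/negP=> ex.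
have : [set u; v; x] \subset [set u in X | ~~ e h u].
  by apply/subsetP=> y; rewrite !inE -orbA => /or3P[] /eqP->; rewrite ?uX ?vX ?xX.
move/subset_leq_card; rewrite setUC cardsU1 cards2 !inE uv eq_sym (negPf ux).
by rewrite eq_sym (negPf vx) => /leq_trans/(_ (missK hK)).
Qed.

Lemma weakX u : u \in weak_links -> u \in X.
Proof. by rewrite inE => /andP[]. Qed.

Lemma weak_nadj_next u : u \in weak_links -> ~~ adj u (s u).
Proof. by rewrite inE => /andP[]. Qed.

Lemma common_misses_gt0 u v h :
  h \in K -> ~~ e h u -> ~~ e h v -> 0 < common_misses u v.
Proof. by move=> hK eu ev; apply/card_gt0P; exists h; rewrite inE hK eu. Qed.

Lemma common_missesP u v : 0 < common_misses u v ->
  exists h, [/\ h \in K, ~~ e h u & ~~ e h v].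
Proof. by case/card_gt0P=> h; rewrite inE => /and3P[]; exists h. Qed.

(** A hyperedge missing both first ends or both second ends makes the left side of [swap_links]
    positive, hence also the right side. *)
Lemma common_misses_swap u v h : u \in weak_links -> v \in weak_links -> u != v ->
    h \in K -> ~~ e h u && ~~ e h v || ~~ e h (s u) && ~~ e h (s v) ->
  exists h0, h0 \in K /\
    (~~ e h0 u && ~~ e h0 (s u) || ~~ e h0 v && ~~ e h0 (s v)).
Proof.
move=> uW vW uv hK hit; have := swap_links uW vW uv => le.
have : 0 < common_misses u (s u) + common_misses v (s v).
  apply: leq_trans le; rewrite addn_gt0.
  by case/orP: hit => /andP[h1 h2]; rewrite (common_misses_gt0 hK h1 h2) ?orbT.
by rewrite addn_gt0 => /orP[] /common_missesP[h0 [h0K m1 m2]]; exists h0;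
   rewrite h0K m1 m2 ?orbT.
Qed.

(** If [N] were smaller, some [h1] outside it would contain two of the last three vertices but none
    of the three links, so it would miss [q] and [s (s q)]. The exchange then yields [h0] missing
    one outer link, thus containing the other. So [h0] lies in [N], besides two hyperedges through
    the middle link. *)
Lemma three_consecutive_links q (N : {set V}) :
    q \in weak_links -> s q \in weak_links -> s (s q) \in weak_links ->
    (forall i h, i \in [:: q; s q; s (s q)] -> h \in K -> e h i -> e h (s i) ->
      h \in N) ->
  3 <= #|N|.
Proof.
move=> W0 W1 W2 inN; rewrite leqNgt; apply/negP=> ltN.
have [X0 X1 X2] := And3 (weakX W0) (weakX W1) (weakX W2); have X3 := sX X2.
have n01 : q != s q by rewrite eq_sym s_neq.
have n12 : s q != s (s q) by rewrite eq_sym s_neq.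
have n23 : s (s q) != s (s (s q)) by rewrite eq_sym s_neq.
have n02 : q != s (s q) by rewrite eq_sym ss_neq.
have n13 : s q != s (s (s q)) by rewrite eq_sym ss_neq.
have notN h : h \notin N -> h \in K -> [/\ ~~ (e h q && e h (s q)),
    ~~ (e h (s q) && e h (s (s q))) & ~~ (e h (s (s q)) && e h (s (s (s q))))].
  by move=> nN hK; split; apply: contra nN => /andP[];
     apply: inN; rewrite ?inE ?eqxx ?orbT.
have [h1] : exists h, h \in [set h in K | [|| e h (s q) && e h (s (s q)),
    e h (s q) && e h (s (s (s q))) | e h (s (s q)) && e h (s (s (s q)))]] :\: N.
  apply: card_ltn_setD; apply: leq_trans ltN _.
  by apply: tripleK; rewrite ?weak_nadj_next // weak_nadjS.
rewrite !inE => /andP[/notN nN /andP[h1K hit1]].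
have {nN}[/andP[ne0 e1] /andP[ne2 e3]] : (~~ e h1 q && e h1 (s q)) /\
    (~~ e h1 (s (s q)) && e h1 (s (s (s q)))).
  by move: hit1; have [] := nN h1K; do 4!case: (e h1 _).
have n03 : q != s (s (s q)) by apply: contraNneq ne0 => ->.
have [h0 [h0K miss0]] : exists h0, h0 \in K /\
    (~~ e h0 q && ~~ e h0 (s q) || ~~ e h0 (s (s q)) && ~~ e h0 (s (s (s q)))).
  by apply: (common_misses_swap W0 W2 n02 h1K); rewrite ne0 ne2.
have h0N : h0 \in N.
  case/orP: miss0 => /andP[m1 m2].
    by apply: (inN (s (s q))); rewrite ?inE ?eqxx ?orbT //; apply: hits_third m1 m2.
  by apply: (inN q); rewrite ?inE ?eqxx ?orbT //; apply: hits_third m1 m2;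
     rewrite // eq_sym.
move: ltN; apply/negP; rewrite -leqNgt.
apply: (ltn_cardsU1 h0N) (pairK X1 X2 n12 (weak_nadj_next W1)).
  by rewrite inE; case/orP: miss0 => /andP[/negPf m1 /negPf m2];
     rewrite ?m1 ?m2 ?andbF.
apply/subsetP=> h; rewrite inE => /and3P[hK ea eb].
by apply: (inN (s q)); rewrite ?inE ?eqxx ?orbT.
Qed.

(** [h0] misses [s q] and [s (s q)], so it contains the link at [s r] and lies in [N]. Three further
    members of [N] each contain [s q] or [s (s q)], or come from an exchange. *)
Lemma two_link_pairs_miss q r (N : {set V}) h h0 :
    q \in weak_links -> s q \in weak_links -> r \in weak_links ->
    s r \in weak_links -> q != r -> q != s r -> r != s q ->
    (forall i h, i \in [:: q; s q; r; s r] -> h \in K -> e h i -> e h (s i) ->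
      h \in N) ->
    h \in K -> ~~ e h (s q) -> ~~ e h (s r) ->
    h0 \in K -> ~~ e h0 (s q) -> ~~ e h0 (s (s q)) ->
  4 <= #|N|.
Proof.
move=> Wx Wa Wz Wb xz xb za inN hK ha hb h0K m0a m0y.
have [Xx Xa Xz Xb] := And4 (weakX Wx) (weakX Wa) (weakX Wz) (weakX Wb).
have [Xy Xw] := (sX Xa, sX Xb).
have ab : s q != s r by rewrite (inj_eq s_inj).
have xa : q != s q by rewrite eq_sym s_neq.
have xy : q != s (s q) by rewrite eq_sym ss_neq.
have ay : s q != s (s q) by rewrite eq_sym s_neq.
have zb : r != s r by rewrite eq_sym s_neq.
have zw : r != s (s r) by rewrite eq_sym ss_neq.
have bw : s r != s (s r) by rewrite eq_sym s_neq.
have yb : s (s q) != s r by rewrite (inj_eq s_inj) eq_sym.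
have aw : s q != s (s r) by rewrite (inj_eq s_inj).
have yw : s (s q) != s (s r) by rewrite !(inj_eq s_inj).
have Nx h' : h' \in K -> e h' q -> e h' (s q) -> h' \in N.
  by apply: inN; rewrite !inE eqxx.
have Na h' : h' \in K -> e h' (s q) -> e h' (s (s q)) -> h' \in N.
  by apply: inN; rewrite !inE eqxx ?orbT.
have Nz h' : h' \in K -> e h' r -> e h' (s r) -> h' \in N.
  by apply: inN; rewrite !inE eqxx ?orbT.
have Nb h' : h' \in K -> e h' (s r) -> e h' (s (s r)) -> h' \in N.
  by apply: inN; rewrite !inE eqxx ?orbT.
have h0b : e h0 (s r) by apply: hits_third m0a m0y.
have h0w : e h0 (s (s r)) by apply: hits_third m0a m0y.
have h0N : h0 \in N by apply: Nb.
(* If the four links are consecutive, exchanging the links at [q] and [r] gives [h1], which misses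
   one of them and contains the other; two hyperedges through the link at [s q] complete the
   count. *)
have [yz|yz] := eqVneq (s (s q)) r.
  have [h1 [h1K miss1]] : exists h1, h1 \in K /\
      (~~ e h1 q && ~~ e h1 (s q) || ~~ e h1 r && ~~ e h1 (s r)).
    by apply: (common_misses_swap Wx Wz xz hK); rewrite ha hb orbT.
  have h1N : h1 \in N.
    case/orP: miss1 => /andP[m1 m2].
      by apply: Nz => //; apply: hits_third m1 m2; rewrite // eq_sym.
    by apply: Nx => //; apply: hits_third m1 m2; rewrite // eq_sym.
  have h01 : h0 != h1.
    apply/eqP=> h01; case/orP: miss1; rewrite -h01 => /andP[m1 m2].
      by case/negP: m0y; apply: hits_third m1 m2.
    by rewrite h0b in m2.
  pose P := [set h in K | e h (s q) && e h (s (s q))].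
  have sPN : P \subset N by apply/subsetP=> h'; rewrite inE => /and3P[]; apply: Na.
  have h1P : h1 \notin P.
    by rewrite inE yz; case/orP: miss1 => /andP[/negPf m1 /negPf m2];
       rewrite ?m1 ?m2 ?andbF.
  apply: (@ltn_cardsU1 _ h0 (h1 |: P));
    rewrite // ?inE ?negb_or ?h01 ?(negPf m0a) ?andbF //.
    by rewrite subUset sub1set h1N.
  rewrite cardsU1 h1P ltnS.
  exact: pairK Xa Xy ay (weak_nadj_next Wa).
(* Otherwise three large hyperedges contain two of [s q], [s (s q)], [s r]. Each contains one of the
   four links, since it misses at most two vertices. *)
pose T := [set h in K | [|| e h (s q) && e h (s (s q)), e h (s q) && e h (s r)
                         | e h (s (s q)) && e h (s r)]].
have leT : 3 <= #|T|.
  apply: tripleK; rewrite ?weak_nadj_next //; first exact: weak_nadj.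
  by apply: weak_nadjS; rewrite // eq_sym.
apply: (ltn_cardsU1 h0N) leT.
  by rewrite inE (negPf m0a) (negPf m0y) !andbF.
apply/subsetP=> h'; rewrite inE => /andP[h'K].
case/or3P=> /andP[e1 e2]; first exact: Na.
  have [ex|mx] := boolP (e h' q); first exact: Nx.
  have [ey|my] := boolP (e h' (s (s q))); first exact: Na.
  by apply: Nz => //; apply: hits_third mx my.
have [ea|ma] := boolP (e h' (s q)); first exact: Na.
have [ez|mz] := boolP (e h' r); first exact: Nz.
by apply: Nb => //; apply: hits_third mz ma.
Qed.

(** Exchanging the links at [s q] and [s r], whose first ends [h] misses, supplies the hyperedge
    [h0] of the previous lemma, up to swapping [q] and [r]. *)
Lemma two_link_pairs q r (N : {set V}) h :
    q \in weak_links -> s q \in weak_links -> r \in weak_links ->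
    s r \in weak_links -> q != r -> q != s r -> r != s q ->
    (forall i h, i \in [:: q; s q; r; s r] -> h \in K -> e h i -> e h (s i) ->
      h \in N) ->
    h \in K -> ~~ e h (s q) -> ~~ e h (s r) ->
  4 <= #|N|.
Proof.
move=> Wx Wa Wz Wb xz xb za inN hK ha hb.
have ab : s q != s r by rewrite (inj_eq s_inj).
have [|h0 [h0K]] := common_misses_swap Wa Wb ab hK; first by rewrite ha hb.
case/orP=> /andP[m1 m2]; first exact:
  (two_link_pairs_miss Wx Wa Wz Wb _ _ _ inN hK ha hb h0K).
apply: (two_link_pairs_miss Wz Wb Wx Wa _ _ _ _ hK hb ha h0K m1 m2) => //.
  by rewrite eq_sym.
by move=> i h' i4; apply: inN; move: i4; rewrite !inE orbA orbC -orbA.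
Qed.

Lemma weak_links_hall (L : {set V}) : L \subset weak_links ->
  #|L| <= #|\bigcup_(u in L) [set h in K | e h u && e h (s u)]|.
Proof.
move=> sLW; set N := \bigcup_(u in L) _.
have inN i h : i \in L -> h \in K -> e h i -> e h (s i) -> h \in N.
  by move=> iL hK e1 e2; apply/bigcupP; exists i; rewrite // inE hK e1.
rewrite leqNgt; apply/negP=> ltNL.
have WL i : i \in L -> i \in weak_links by apply: (subsetP sLW).
have leLK : #|L| <= #|K| by apply: leq_trans leWK; apply: subset_leq_card.
(* A large hyperedge [h] containing no link of [L]. *)
have [h] := card_ltn_setD (leq_trans ltNL leLK); rewrite inE => /andP[hN hK].
(* The two vertices may coincide, and they are arbitrary if [h] misses nothing. *)
have [a [b Mab]] : exists a b, [set u in X | ~~ e h u] \subset [set a; b].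
  have := missK hK; rewrite leq_eqVlt => /orP[/cards2P[a [b [_ ->]]]|].
    by exists a, b.
  rewrite ltnS => /card_le1_eqP M1.
  have [->|[a aM]] := set_0Vmem [set u in X | ~~ e h u].
    by exists h, h; rewrite sub0set.
  exists a, a; apply/subsetP=> u uM; rewrite (M1 u a uM aM) !inE eqxx //.
(* Every link of [L] has an end missed by [h]. *)
have sL : L \subset [set a; p a; b; p b].
  apply/subsetP=> i iL; have iX := weakX (WL i iL).
  have : (i \in [set a; b]) || (s i \in [set a; b]).
    have [ei|mi] := boolP (e h i); last by rewrite (subsetP Mab) // inE iX.
    have [es|ms] := boolP (e h (s i)); first by case/negP: hN; apply: (inN i).
    by rewrite orbC (subsetP Mab) // inE sX.
  rewrite !inE -!(inj_eq s_inj i) !psK.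
  by case/orP=> /orP[] -> //; rewrite ?orbT.
have L_not_pair u v : 3 <= #|L| -> ~ L \subset [set u; v].
  move=> le3 /subset_leq_card/(leq_trans le3).
  by rewrite cards2; case: eqP.
have [le3|] := boolP (3 <= #|L|); last first.
  rewrite -ltnNge ltnS => le2.
  have /card_gt0P[i iL] : 0 < #|L| by apply: leq_ltn_trans ltNL.
  have iX := weakX (WL i iL).
  have sub : [set h in K | e h i && e h (s i)] \subset N by apply: bigcup_sup.
  have := leq_trans ltNL le2; apply/negP; rewrite -leqNgt.
  apply: leq_trans (subset_leq_card sub).
  by apply: pairK; rewrite ?sX ?weak_nadj_next ?WL // eq_sym s_neq.
have [le4|] := boolP (4 <= #|L|).
  have cardab : #|[set a; p a; b; p b]| = #|undup [:: a; p a; b; p b]|.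
    by apply: eq_card => x; rewrite mem_undup !inE -!orbA.
  have eq4 : size (undup [:: a; p a; b; p b]) = 4.
    apply/eqP; rewrite eqn_leq (size_undup [:: a; p a; b; p b]).
    rewrite -(card_uniqP (undup_uniq _)) -cardab.
    by apply: leq_trans le4 (subset_leq_card sL).
  have uab : uniq [:: a; p a; b; p b] by rewrite -[uniq _]negbK -ltn_size_undup eq4.
  have eqL : L = [set a; p a; b; p b].
    apply/eqP; rewrite eqEcard sL; apply: leq_trans le4.
    by rewrite cardab (card_uniqP (undup_uniq _)) eq4.
  have [aL paL bL pbL] : [/\ a \in L, p a \in L, b \in L & p b \in L].
    by rewrite eqL !inE !eqxx ?orbT.
  move: uab; rewrite /= !inE !negb_or.
  case/and4P=> [/and3P[a_pa ab a_pb] /andP[pa_b pa_pb] b_pb _].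
  (* A link of [L] whose first end is in [h] must have its second end missed; this applies to the
     links ending at [a] and [b]. *)
  have missed i : s i \in L -> i \in L -> i \notin [set a; b] -> ~~ e h (s i).
    move=> sL' iL iab; apply: contra hN => es; apply: (inN i) => //.
    apply: contraNT iab => mi; rewrite (subsetP Mab) // inE mi.
    by rewrite (weakX (WL i iL)).
  have lt4 : #|N| < 4.
    apply: leq_trans ltNL _; rewrite eqL cardab (card_uniqP (undup_uniq _)).
    by rewrite eq4.
  move: lt4; apply/negP; rewrite -leqNgt.
  apply: (@two_link_pairs (p a) (p b) N h); rewrite ?psK ?WL // 1?eq_sym //.
  - by move=> i h'; rewrite !inE => i4; apply: inN; case/or4P: i4 => /eqP->.
  - by rewrite -[a]psK missed ?psK // !inE negb_or eq_sym a_pa.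
  - by rewrite -[b]psK missed ?psK // !inE negb_or eq_sym a_pb eq_sym.
rewrite -ltnNge ltnS => leL3.
have ltN3 : #|N| < 3 by apply: leq_trans ltNL leL3.
(* Three elements among [a], [p a], [b], [p b] include a whole pair, that is, two consecutive
   links. *)
have [q [qL sqL]] : exists q, q \in L /\ s q \in L.
  have [aL|aL] := boolP ((a \in L) && (p a \in L)).
    by exists (p a); rewrite psK; case/andP: aL.
  have [bL|bL] := boolP ((b \in L) && (p b \in L)).
    by exists (p b); rewrite psK; case/andP: bL.
  case: (L_not_pair (if a \in L then a else p a) (if b \in L then b else p b) le3).
  apply/subsetP=> i iL; have := subsetP sL i iL; rewrite !inE -!orbA.
  case/or4P=> /eqP ii; rewrite -ii ?iL ?eqxx ?orbT //.
  - by move: aL; rewrite -ii iL andbT => /negPf->; rewrite eqxx.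
  - by move: bL; rewrite -ii iL andbT => /negPf->; rewrite eqxx orbT.
have [i] : exists i, i \in L :\: [set q; s q].
  by apply: card_ltn_setD; apply: leq_trans le3; rewrite cards2; case: eqP.
rewrite !inE negb_or => /andP[/andP[iq isq] iL].
have [Wq Wsq Wi] := And3 (WL q qL) (WL _ sqL) (WL i iL).
have [Xq Xsq Xi] := And3 (weakX Wq) (weakX Wsq) (weakX Wi).
have sisq : s i != s q by rewrite (inj_eq s_inj).
(* [h'] contains [s q] and no link of [L], so it misses [q], [s (s q)] and an end of the link at
   [i]. These are three vertices unless the links at [q], [s q], [i] are consecutive. *)
have [h'] : exists h', h' \in [set h in K | [|| e h (s q) && e h i,
    e h (s q) && e h (s i) | e h i && e h (s i)]] :\: N.
  apply: card_ltn_setD; apply: leq_trans ltN3 _.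
  apply: tripleK; rewrite ?sX ?weak_nadj_next // 1?eq_sym //.
  - by rewrite s_neq.
  - by apply: weak_nadj; rewrite // eq_sym.
  - by apply: weak_nadjS; rewrite // eq_sym.
rewrite !inE => /andP[h'N /andP[h'K hit]].
have nzw : ~~ (e h' i && e h' (s i)).
  by apply: contra h'N => /andP[]; apply: inN.
have ea : e h' (s q) by move: hit; rewrite (negPf nzw) orbF -andb_orr => /andP[].
have mx : ~~ e h' q by apply: contra h'N => ex; apply: (inN q).
have my : ~~ e h' (s (s q)) by apply: contra h'N => ey; apply: (inN (s q)).
have xy : q != s (s q) by rewrite eq_sym ss_neq.
have three_consecutive j : j \in L -> s j \in L -> s (s j) \in L -> False.
  move=> L0 L1 L2; move: ltN3; apply/negP; rewrite -leqNgt.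
  apply: (three_consecutive_links (WL _ L0) (WL _ L1) (WL _ L2)) => k h'' k3.
  by apply: inN; move: k3; rewrite !inE => /or3P[] /eqP->.
move: nzw; rewrite negb_and => /orP[mz|mw].
  have [ssq|ssq] := eqVneq (s (s q)) i.
    by apply: (three_consecutive q); rewrite // ssq.
  by case/negP: mz; apply: hits_third mx my; rewrite ?sX // eq_sym.
have [si|si] := eqVneq q (s i).
  by apply: (three_consecutive i); rewrite -?si.
case/negP: mw; apply: hits_third mx my; rewrite ?sX //.
by rewrite (inj_eq s_inj) eq_sym.
Qed.

End HallCondition.

(** * Hyperedges of the bipartite graph and alternating cycles *)

Section BipartiteGraph.
Variables (V : finType) (e : rel V) (X Y : {set V}).
Hypothesis HG : bipartite_graph e X Y.

Definition joined_by_deg2 : rel V :=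
  [rel u v | [exists y, [&& degree e y == 2, e y u & e y v]]].

Definition large_vertices := [set y in Y | 3 <= degree e y].

Lemma edgeC : symmetric e.
Proof. by case: HG => [[]]. Qed.

Lemma nbr_X_in_Y y u : u \in X -> e y u -> y \in Y.
Proof.
case: HG => _ _ dXY bip uX /bip /orP[] /andP[] // _ uY.
by have := disjointFr dXY uX; rewrite uY.
Qed.

Lemma nbr_Y_in_X y u : y \in Y -> e y u -> u \in X.
Proof.
case: HG => _ _ dXY bip yY /bip /orP[] /andP[] // yX.
by have := disjointFr dXY yX; rewrite yY.
Qed.

Lemma joined_by_deg2C : symmetric joined_by_deg2.
Proof. by move=> u v; apply: eq_existsb => y; rewrite [e y u && _]andbC. Qed.

(** Inserting [f u] after each [u] of the cyclic order gives the cycle. Its vertices are distinct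
    because [f] is injective on [X] and takes values in [Y]. *)
Lemma alternating_cycle (s : seq V) (f : V -> V) :
    uniq s -> s =i X -> 1 < size s -> {in X &, injective f} ->
    {in X, forall u, e u (f u) && e (f u) (next s u)} ->
  exists c : seq V, graph_cycle e c /\ {subset X <= c}.
Proof.
move=> us sX s_gt1 f_inj ef; pose dup := fun t => flatten [seq [:: u; f u] | u <- t].
have mem_dup t x : (x \in dup t) = (x \in t) || (x \in map f t).
  elim: t => //= u t IHt; rewrite !inE IHt.
  by case: (x == u); case: (x == f u); rewrite ?orbT.
have fY u : u \in X -> f u \in Y.
  by move=> uX; have /andP[] := ef u uX; rewrite edgeC => /(nbr_X_in_Y uX).
have YX u : u \in Y -> u \notin X.
  by case: HG => _ _ dXY _ uY; rewrite (disjointFl dXY).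
have size_dup t : size (dup t) = (size t).*2 by elim: t => //= u t ->.
exists (dup s); split; last by move=> u; rewrite -sX mem_dup => ->.
split; first by rewrite size_dup; lia.
have uniq_dup t : {subset t <= X} -> uniq t -> uniq (dup t).
  elim: t => //= u t IHt tX /andP[ut /IHt-> //]; last first.
    by move=> x xt; apply: tX; rewrite inE xt orbT.
  have uX : u \in X by apply: tX; rewrite mem_head.
  have tX' x : x \in t -> x \in X by move=> xt; apply: tX; rewrite inE xt orbT.
  rewrite inE !mem_dup !negb_or ut andbT -!andbA /=; apply/and4P; split.
  - by apply/eqP=> ufu; have := YX _ (fY u uX); rewrite -ufu uX.
  - by apply/negP=> /mapP[x /tX' xX ux]; have := YX _ (fY x xX); rewrite -ux uX.
  - by apply/negP=> /tX' fX; have := YX _ (fY u uX); rewrite fX.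
  - by apply/negP=> /mapP[x xt /(f_inj _ _ uX (tX' x xt)) ux]; rewrite ux xt in ut.
rewrite /ucycle /ucycleb uniq_dup ?andbT //; last by move=> u; rewrite sX.
pose r := [rel u v | e u (f u) && e (f u) v].
have : cycle r s.
  apply: (@sub_in_cycle _ [in X] (frel (next s))); last exact: cycle_next.
    by move=> u v uX _ /= /eqP <-; apply: ef.
  by apply/allP=> u; rewrite sX.
case: (s) => //= x t.
have path_dup z y : path r z (rcons t y) ->
    path e z (f z :: rcons (dup t) y).
  elim: t z => [|u t IHt] z /=; first by rewrite !andbT.
  by case/andP=> /andP[-> ->] /IHt /=.
exact: path_dup.
Qed.

(** * The double Hall property on sets with no pair joined in degree 2 *)

Hypothesis HH : double_hall e X.

(** A vertex of degree 2 in [Lambda2 e S] would join two vertices of [S], so only large ones are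
    counted. *)
Lemma double_hall_independent (S : {set V}) : S \subset X -> 2 <= #|S| ->
    {in S &, forall u v, u != v -> ~~ joined_by_deg2 u v} ->
  #|S| <= #|[set h in large_vertices | 2 <= #|neighbors e h :&: S|]|.
Proof.
move=> sSX S2 indS; apply: leq_trans (HH sSX S2) _; apply: subset_leq_card.
apply/subsetP=> y; rewrite !inE => yS; rewrite yS andbT.
have /card_gt1P[u [v [/setIP[yu uS] /setIP[yv vS] uv]]] := yS.
rewrite !inE in yu yv; rewrite (nbr_X_in_Y (subsetP sSX _ uS) yu) /=.
have : 2 <= degree e y by apply: leq_trans yS (subset_leq_card (subsetIl _ _)).
rewrite leq_eqVlt => /orP[/eqP d2|//]; case/negP: (indS u v uS vS uv).
by apply/existsP; exists y; rewrite -d2 yu.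
Qed.

Lemma double_hall_pair u v : u \in X -> v \in X -> u != v ->
    ~~ joined_by_deg2 u v ->
  2 <= #|[set h in large_vertices | e h u && e h v]|.
Proof.
move=> uX vX uv nuv; have sz : #|[set u; v]| = 2 by rewrite cards2 uv.
have := @double_hall_independent [set u; v]; rewrite sz => le2.
apply: leq_trans (le2 _ _ _) _ => //.
- by apply/subsetP=> x; rewrite !inE => /orP[] /eqP->.
- move=> x y; rewrite !inE => /orP[] /eqP-> /orP[] /eqP->; rewrite ?eqxx //.
  by rewrite joined_by_deg2C.
apply: subset_leq_card; apply/subsetP=> h; rewrite !inE => /andP[-> h2] /=.
have: [set u; v] \subset neighbors e h.
  by apply/setIidPr/eqP; rewrite eqEcard subsetIr sz.
by rewrite subUset !sub1set !inE.
Qed.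

Lemma double_hall_triple u v x : u \in X -> v \in X -> x \in X ->
    u != v -> u != x -> v != x -> ~~ joined_by_deg2 u v ->
    ~~ joined_by_deg2 u x -> ~~ joined_by_deg2 v x ->
  3 <= #|[set h in large_vertices |
           [|| e h u && e h v, e h u && e h x | e h v && e h x]]|.
Proof.
move=> uX vX xX uv ux vx nuv nux nvx.
have sz : #|[set u; v; x]| = 3.
  by rewrite setUC cardsU1 cards2 !inE uv eq_sym (negPf ux) eq_sym (negPf vx).
have := @double_hall_independent [set u; v; x]; rewrite sz => le3.
apply: leq_trans (le3 _ _ _) _ => //.
- by apply/subsetP=> y; rewrite !inE -orbA => /or3P[] /eqP->.
- move=> y z; rewrite !inE -!orbA => /or3P[] /eqP-> /or3P[] /eqP->;
  by rewrite ?eqxx // joined_by_deg2C.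
apply: subset_leq_card; apply/subsetP=> h; rewrite !inE => /andP[-> h2] /=.
have /card_gt1P[y [z [/setIP[hy yS] /setIP[hz zS] yz]]] := h2.
move: yS zS hy hz yz; rewrite !inE -!orbA.
by case/or3P=> /eqP-> /or3P[] /eqP->; rewrite ?eqxx //;
   move=> hy hz _; rewrite hy hz ?orbT.
Qed.

Hypothesis Hdeg : forall y, y \in Y ->
  degree e y \in [:: 2; #|X| - 2; #|X| - 1; #|X|].

(** A degree of at least 3 rules out the value 2, and the other allowed degrees are at least
    [#|X| - 2]. *)
Lemma large_vertices_miss :
  {in large_vertices, forall h, #|[set u in X | ~~ e h u]| <= 2}.
Proof.
move=> h; rewrite inE => /andP[hY h3].
have -> : [set u in X | ~~ e h u] = X :\: neighbors e h.
  by apply/setP=> u; rewrite !inE andbC.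
have sub : neighbors e h \subset X.
  by apply/subsetP=> u; rewrite inE; apply: nbr_Y_in_X.
rewrite cardsD (setIidPr sub) -/(degree e h).
by have := Hdeg hY; rewrite !inE => /or4P[] /eqP; lia.
Qed.

(** * Construction of the cycle through [X] *)

(** Both links of the cyclic order join the same two vertices here, so this case is separate: two
    common neighbours close a 4-cycle. *)
Lemma double_hall_pair_cycle : #|X| = 2 ->
  exists c : seq V, graph_cycle e c /\ {subset X <= c}.
Proof.
move=> X2; have : 1 < #|Lambda2 e X| by rewrite -{1}X2 HH ?X2.
have /eqP/cards2P[u [v [uv defX]]] := X2.
have LX y : y \in Lambda2 e X -> e y u && e y v.
  rewrite inE -X2 => le; have : X \subset neighbors e y.
    by apply/setIidPr/eqP; rewrite eqEcard subsetIr.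
  by rewrite defX subUset !sub1set !inE.
case/card_gt1P=> y [z [/LX/andP[yu yv] /LX/andP[zu zv] yz]].
have uX : u \in X by rewrite defX !inE eqxx.
have vX : v \in X by rewrite defX !inE eqxx orbT.
have us : uniq [:: u; v] by rewrite /= inE uv.
pose f x := if x == u then y else z.
apply: (@alternating_cycle [:: u; v] f) => //.
- by move=> x; rewrite defX !inE.
- move=> x x'; rewrite defX !inE /f => /orP[] /eqP-> /orP[] /eqP->;
  by rewrite ?eqxx // [v == u]eq_sym (negPf uv) => eq_yz; rewrite eq_yz eqxx in yz.
- move=> x; rewrite defX !inE /f => /orP[] /eqP->; rewrite /= ?eqxx.
    by rewrite edgeC yu.
  by rewrite [v == u]eq_sym (negPf uv) edgeC zv.
Qed.

Lemma double_hall_cycle : 3 <= #|X| ->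
  exists c : seq V, graph_cycle e c /\ {subset X <= c}.
Proof.
move=> X3; pose adj := joined_by_deg2; pose K := large_vertices.
pose cm := common_misses e K.
(* The constant exceeds any sum of two values of cm, so the weight compares
   lexicographically under an exchange of two links. *)
pose w u v := if adj u v then (#|V|).*2.+1 else cm u v.
have cmC u v : cm u v = cm v u.
  by apply: eq_card => h; rewrite !inE [~~ e h u && _]andbC.
have cm_le u v : cm u v <= #|V| by apply: max_card.
have wC u v : w u v = w v u by rewrite /w /adj joined_by_deg2C cmC.
have [s [us sX opt]] := max_cyclic_order wC X.
have size_s : size s = #|X| by rewrite -(card_uniqP us); apply: eq_card.
have nX : {in X, forall u, next s u \in X} by move=> u; rewrite -!sX mem_next.
have n_inj : injective (next s) by apply: can_inj (prev_next us).
have n_neq : {in X, forall u, next s u != u /\ next s (next s u) != u}.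
  move=> u; rewrite -sX => /rot_to[i t def_s].
  have ut : uniq (rot i s) by rewrite rot_uniq.
  rewrite -!(next_rot i us) def_s; have := congr1 size def_s.
  rewrite size_rot size_s; rewrite def_s in ut.
  case: t ut {def_s} => [|a [|b t]] /= ut; try lia.
  move=> _; move: ut; rewrite !inE !negb_or => /andP[/and3P[ua ub _] _].
  by rewrite !eqxx ![a == u]eq_sym (negPf ua) ?eqxx [b == u]eq_sym ub.
pose W := weak_links adj X (next s).
have WX u : u \in W -> u \in X by rewrite inE => /andP[].
have wW u : u \in W -> w u (next s u) = cm u (next s u).
  by rewrite inE /w => /andP[_ /negPf->].
(* Otherwise an exchange would gain at least [(#|V|).*2.+1] and lose at most [(#|V|).*2]. *)
have W_nadj : {in W &, forall u v, u != v ->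
    ~~ adj u v /\ ~~ adj (next s u) (next s v)}.
  move=> u v uW vW uv; have := opt u v (WX u uW) (WX v vW) uv.
  rewrite !wW // /w.
  have := cm_le u (next s u); have := cm_le v (next s v).
  by do 2!case: (adj _ _) => /=; lia.
have [f [f_inj fW]] : exists f : V -> V, {in W &, injective f} /\
    {in W, forall u, f u \in [set h in K | e h u && e h (next s u)]}.
  have /card_gt0P[x0 _] : 0 < #|X| by lia.
  apply: hall_marriage => // L.
  apply: (@weak_links_hall V e adj X K (next s) (prev s)) => //.
  - exact: next_prev.
  - by move=> u /n_neq[].
  - by move=> u /n_neq[].
  - exact: large_vertices_miss.
  - exact: double_hall_pair.
  - exact: double_hall_triple.
  - by move=> u v uW vW uv; have [] := W_nadj u v uW vW uv.
  - by move=> u v uW vW uv; have [] := W_nadj u v uW vW uv.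
  - move=> u v uW vW uv; have := opt u v (WX u uW) (WX v vW) uv.
    have [/negPf a1 /negPf a2] := W_nadj u v uW vW uv.
    by rewrite !wW // /w a1 a2.
  (* First ends of weak links are pairwise not joined, so the double Hall property gives [#|W|]
     large vertices; a single weak link is handled by its own two ends. *)
  - have [W2|] := boolP (2 <= #|W|).
      apply: leq_trans (double_hall_independent _ W2 _) _.
      + by apply/subsetP.
      + by move=> u v uW vW uv; have [] := W_nadj u v uW vW uv.
      + by apply: subset_leq_card; apply/subsetP=> h; rewrite inE => /andP[].
    rewrite -ltnNge ltnS leq_eqVlt ltnS leqn0 => /orP[/cards1P[u defW]|/eqP->//].
    have : u \in W by rewrite defW inE.
    rewrite {1}/W inE -/W defW cards1 => /andP[uX nadj].
    have [nu _] := n_neq u uX; rewrite eq_sym in nu.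
    have := ltnW (double_hall_pair uX (nX u uX) nu nadj).
    by case/card_gt0P=> h; rewrite inE => /andP[hK _]; apply/card_gt0P; exists h.
(* The default [u] is never taken for [u] in [X] outside [W]. *)
pose g u := odflt u [pick y | [&& degree e y == 2, e y u & e y (next s u)]].
have gP u : u \in X -> u \notin W ->
    [&& degree e (g u) == 2, e (g u) u & e (g u) (next s u)].
  rewrite inE => uX; rewrite uX negbK => /existsP[y yP].
  by rewrite /g; case: pickP => [//|/(_ y)]; rewrite yP.
have fP u : u \in W -> [&& 3 <= degree e (f u), e (f u) u & e (f u) (next s u)].
  by move/fW; rewrite !inE => /andP[/andP[_ ->]].
have fg u v : u \in W -> v \in X -> v \notin W -> f u <> g v.
  move=> /fP/andP[d3 _] vX /(gP v vX)/andP[/eqP d2 _] eq_fg.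
  by rewrite eq_fg d2 in d3.
(* A vertex of degree 2 determines the ends of its link; two distinct links with the same ends would
   make [next s (next s u)] equal to [u]. *)
have g_inj u v : u \in X -> v \in X -> u \notin W -> v \notin W ->
    g u = g v -> u = v.
  move=> uX vX uW vW eq_g; apply/eqP/negPn/negP=> uv.
  have /and3P[d2 gu gsu] := gP u uX uW.
  have /and3P[_ gv gsv] := gP v vX vW; rewrite -eq_g in gv gsv.
  have [nu nnu] := n_neq u uX.
  have Ng : neighbors e (g u) = [set u; next s u].
    apply/esym/eqP; rewrite eqEcard subUset !sub1set !inE gu gsu /=.
    by rewrite cards2 eq_sym nu -/(degree e (g u)) (eqP d2).
  have : v \in neighbors e (g u) by rewrite inE.
  have : next s v \in neighbors e (g u) by rewrite inE.
  rewrite Ng !inE [v == u]eq_sym (negPf uv) (inj_eq n_inj) [v == u]eq_sym (negPf uv).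
  by rewrite orbF => /eqP eqv /= /eqP vu; move: nnu; rewrite -vu eqv eqxx.
apply: (@alternating_cycle s (fun u => if u \in W then f u else g u)) => //.
- by rewrite size_s; lia.
- move=> u v uX vX.
  have [uW|uW] := boolP (u \in W); have [vW|vW] := boolP (v \in W).
  + exact: f_inj.
  + by move/fg=> [].
  + by move/esym/fg=> [].
  + exact: g_inj.
- move=> u uX; have [uW|uW] := boolP (u \in W).
    by have /and3P[_ e1 e2] := fP u uW; rewrite edgeC e1.
  by have /and3P[_ e1 e2] := gP u uX uW; rewrite edgeC e1.
Qed.

End BipartiteGraph.

Theorem theorem1p9 (V : finType) (e : rel V) (X Y : {set V})
    (HG : bipartite_graph e X Y) (HX : 2 <= #|X|) (HH : double_hall e X)
    (Hdeg : forall y, y \in Y ->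
       degree e y \in [:: 2; #|X| - 2; #|X| - 1; #|X|]) :
  exists c : seq V, graph_cycle e c /\ {subset X <= c}.
Proof.
move: HX; rewrite leq_eqVlt => /orP[/eqP/esym X2|X3].
  exact: double_hall_pair_cycle HG HH X2.
exact: double_hall_cycle HG HH Hdeg X3.
Qed.
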